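(* Let $L\ge1$ and $D\ge 2$ be integers, let $\rho_1,\dots,\rho_D>0$, and for $d=1,\dots,D$ set $\sigma_d^2=\frac{1}{1+\rho_d L}$, $G_d=\frac{1}{\rho_d(1-\sigma_d^2)}$ and $\overline{G}_d=\frac1d\sum_{k=1}^d G_k$. Suppose a single access point transmits to $D$ devices, the $d$th having measurement noise-to-signal ratio $G_d$: let $\hat h_1,\dots,\hat h_D$ be independent with $\hat h_d\sim\mathcal{CN}(0,1-\sigma_d^2)$, and let $Y_d=\frac{1}{\log_2(1+\rho_d|\hat h_d|^2)}$. Then for every $y>0$, $$\mathbb{P}\left[\sum_{d=1}^D Y_d\le y\right]\le\exp\left(-D\,\overline{G}_D\left(2^{1/y}-1\right)\right)\cdot\prod_{d=2}^D\frac{J_d}{J_d+G_d},$$ where, for $d=2,\dots,D$, $$J_d=\max_{v>2^{1/y}}\left(\frac{1}{2^{1/y}-v}\right)\ln\left(1-\exp\left((d-1)\,\overline{G}_{d-1}\left(2^{\frac1y}-2^{\frac{\ln v}{y\ln v-\ln 2}}\right)\right)\right).$$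
   Context: $\mathcal{CN}(0,s)$ denotes the circularly symmetric complex Gaussian distribution with mean $0$ and variance $s$ (so $X\sim\mathcal{CN}(0,s)$ has $\mathbb{E}|X|^2=s$). $\hat h_d$ is the MMSE channel estimate for device $d$ (average SNR $\rho_d$) from $L$ pilots, with error variance $\sigma_d^2$. With bandwidth $W$, the rate selected for device $d$ is $R_d=W\log_2(1+\rho_d|\hat h_d|^2)$, and $Y_d=W/R_d$ is the time needed to transmit one bit in one Hertz. The probability bounded is that of time underflow with respect to the deadline $y$. *)

(* Defs.v *)
From mathcomp Require Import all_boot all_order all_algebra.
From mathcomp Require Import complex.
From mathcomp Require Import all_classical all_reals all_analysis.
Import Order.TTheory GRing.Theory Num.Theory numFieldNormedType.Exports.

Set Implicit Arguments.
Unset Strict Implicit.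
Unset Printing Implicit Defensive.

Local Open Scope classical_set_scope.
Local Open Scope ring_scope.

(* Devices are indexed by d = 1, ..., D; values at other indices are unused. *)

Definition sigma2 (R : realType) (rho : nat -> R) (L d : nat) : R :=
  1 / (1 + rho d * L%:R).

Definition G (R : realType) (rho : nat -> R) (L d : nat) : R :=
  1 / (rho d * (1 - sigma2 rho L d)).

Definition Gbar (R : realType) (rho : nat -> R) (L d : nat) : R :=
  (1 / d%:R) * \sum_(1 <= k < d.+1) G rho L k.

Definition log2 (R : realType) (x : R) : R := ln x / ln 2.

(* C identified with R * R, which carries the Borel (product) sigma-algebra;
   R[i] itself has no measurable structure in the library. *)
Definition ReIm (R : realType) (z : R[i]) : (R * R)%type :=
  (complex.Re z, complex.Im z).

(* X ~ CN(0, s), for s > 0: the real and imaginary parts of X are independent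
   centred Gaussians of variance s / 2 each, so that E|X|^2 = s. The second
   parameter of normal_prob is the standard deviation. *)
Definition is_CN (R : realType) (d : measure_display) (T : measurableType d)
    (P : probability T R) (X : T -> R[i]) (s : R) : Prop :=
  measurable_fun setT (fun t => ReIm (X t)) /\
  forall A : set (R * R), measurable A ->
    P [set t | A (ReIm (X t))] =
    (normal_prob (0 : R) (Num.sqrt (s / 2)) \x
     normal_prob (0 : R) (Num.sqrt (s / 2)))%E A.

(* Mutual independence of the complex random variables X i, i in I: the product
   rule holds for every finite subfamily and all Borel subsets of C. *)
Definition mutually_independent (R : realType) (d : measure_display)
    (T : measurableType d) (P : probability T R) (I : set nat)
    (X : nat -> T -> R[i]) : Prop :=
  forall F : seq nat, uniq F -> [set` F] `<=` I ->
  forall A : nat -> set (R * R), (forall i, measurable (A i)) ->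
    P (\bigcap_(i in [set` F]) [set t | A i (ReIm (X i t))]) =
    (\prod_(i <- F) P [set t | A i (ReIm (X i t))])%E.

(* Y_d for a channel estimate h. The inverse is that of extended reals, for
   which 0^-1 = +oo: a vanishing estimate gives an infinite time. *)
Definition Y (R : realType) (rho : nat -> R) (d : nat) (h : R[i]) : \bar R :=
  ((log2 (1 + rho d * Normc.normc h ^+ 2))%:E^-1)%E.

Definition Jobj (R : realType) (rho : nat -> R) (L : nat) (y : R) (d : nat)
    (v : R) : R :=
  (1 / (2 `^ (1 / y) - v)) *
  ln (1 - expR ((d.-1)%:R * Gbar rho L d.-1 *
                (2 `^ (1 / y) - 2 `^ (ln v / (y * ln v - ln 2))))).

Definition Jvalues (R : realType) (rho : nat -> R) (L : nat) (y : R) (d : nat)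
    : set R :=
  [set Jobj rho L y d v | v in [set v | 2 `^ (1 / y) < v]].

Definition is_maximum (R : realType) (A : set R) (m : R) : Prop :=
  A m /\ ubound A m.

(* The supremum is a maximum when is_maximum (Jvalues rho L y d) holds of it. *)
Definition J (R : realType) (rho : nat -> R) (L : nat) (y : R) (d : nat) : R :=
  sup (Jvalues rho L y d).

(* Main.v *)
(* Condition on the last device. With a = 2^(1/y), its SNR x is exponential of
   rate G_d, and given v = 1 + x > a the other d - 1 devices have to meet a
   deadline y' < y with 2^(1/y') = u(v) = 2^(ln v / (y ln v - ln 2)). Inductively
   this has probability at most C exp(- S (u(v) - 1)), S = G_1 + ... + G_(d-1),
   and J_d is the least J such that exp(- S (u(v) - a)) <= 1 - exp(- J (v - a))
   for all v > a; integrating the right-hand side against the law of x gives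
   the factor J_d / (J_d + G_d).

   The induction also needs this inequality, with the same J_d, for shorter
   deadlines. Writing v = a^(1+t) makes u = a^(1+1/t), so v - a = a (a^t - 1) and
   u - a = a (a^(1/t) - 1): if a grows while v - a is kept fixed, t decreases, and
   u - a increases. The same symmetry gives (u - a)(v - a) >= c max(t, 1/t), hence
   the objective tends to 0 at both ends and its maximum is attained. *)

From HB Require Import structures.
Require Import Defs.
From mathcomp Require Import all_boot all_order all_algebra.
From mathcomp Require Import complex.
From mathcomp Require Import all_classical all_reals all_analysis.
From mathcomp Require Import measurable_realfun ring lra.
Import Order.TTheory GRing.Theory Num.Theory numFieldNormedType.Exports.

Local Open Scope classical_set_scope.
Local Open Scope ring_scope.

(** * Integrals against a measure with a density *)

Lemma ge0_integral_density {d} {T : measurableType d} {R : realType}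
    (nu : {finite_measure set T -> \bar R})
    (mu : {sigma_finite_measure set T -> \bar R}) (p : T -> \bar R) :
  mu.-integrable setT p ->
  (forall A, measurable A -> nu A = \int[mu]_(x in A) p x)%E ->
  forall f : T -> \bar R, measurable_fun setT f -> (forall x, 0 <= f x)%E ->
  (\int[nu]_x f x = \int[mu]_x (f x * p x))%E.
Proof.
move=> ip nuE f mf f0.
have dom : nu `<< mu.
  apply/null_content_dominatesP => A mA muA0; rewrite nuE//.
  by apply: null_set_integral => //; apply: measurable_funTS (measurable_int _ ip).
(* The Radon-Nikodym derivative and [p] are both integrable with the same integral over every
   measurable set, so they agree almost everywhere. *)
rewrite -(Radon_Nikodym_SigmaFinite.change_of_variables dom)//.
have mRN := measurable_int _ (Radon_Nikodym_SigmaFinite.f_integrable dom).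
apply: ae_eq_integral => //.
- exact: emeasurable_funM.
- by apply: emeasurable_funM => //; exact: measurable_int ip.
- apply: ae_eqe_mul2l; apply: integral_ae_eq => //.
  + exact: Radon_Nikodym_SigmaFinite.f_integrable.
  + exact: measurable_int ip.
  + by move=> A _ mA; rewrite -Radon_Nikodym_SigmaFinite.f_integral// nuE.
Qed.

Definition pushforward_measure {d d'} {T1 : measurableType d}
    {T2 : measurableType d'} {R : realType} (m : {measure set T1 -> \bar R})
    {f : T1 -> T2} (mf : measurable_fun setT f) : {measure set T2 -> \bar R} :=
  measure_function_pushforward__canonical__measure_function_Measure m mf.

(** * Modulus of a circularly symmetric Gaussian *)

Section lebesgue_symmetries.
Context {R : realType}.
Notation mu := (@lebesgue_measure R).
Local Open Scope ereal_scope.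

(** Lebesgue measure is determined by its values on half-open intervals, and [a] times its image
    under multiplication by [a] has these values. *)
Lemma ge0_integral_scale (a : R) (f : R -> \bar R) : (0 < a)%R ->
  measurable_fun setT f -> (forall x, 0 <= f x) ->
  \int[mu]_x f x = a%:E * \int[mu]_x f (a * x)%R.
Proof.
move=> a0 mf f0.
have ma : measurable_fun [set: measurableTypeR R]
   (( *%R a) : measurableTypeR R -> measurableTypeR R) by exact: measurable_funM.
pose m := pushforward_measure mu ma.
transitivity (\int[mscale (NngNum (ltW a0)) m]_x f x).
  apply: eq_measure_integral => A mA _; apply: lebesgue_measure_unique => //.
  move=> _ [[u v]] _ <-; rewrite /= /mscale/= /m /pushforward.
  rewrite (_ : _ @^-1` _ = `](u / a)%R, (v / a)%R]%classic); last first.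
    apply/seteqP; split=> x /=; rewrite !in_itv/= ltr_pdivrMr// ler_pdivlMr//.
      by rewrite ![(x * a)%R]mulrC.
    by rewrite ![(x * a)%R]mulrC.
  rewrite !lebesgue_measure_itv/= !lte_fin ltr_pM2r ?invr_gt0//.
  case: ifPn => _; last by rewrite mule0.
  by rewrite -!EFinB -mulrBl -EFinM mulrC divfK ?gt_eqF.
rewrite ge0_integral_mscale//; congr (_ * _).
by rewrite ge0_integral_pushforward.
Qed.

Lemma ge0_even_integralT (f : R -> \bar R) : measurable_fun setT f ->
  (forall x, 0 <= f x) -> (forall x, f (- x)%R = f x) ->
  \int[mu]_x f x = 2%:E * \int[mu]_(x in `[0%R, +oo[) f x.
Proof.
move=> mf f0 ef.
have e : setT = `]-oo, 0%R[%classic `|` `[0%R, +oo[%classic :> set R.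
  by apply/seteqP; split=> x //= _; rewrite !in_itv/= andbT; case: ltP; auto.
rewrite e ge0_integral_setU//=; last 2 first.
- exact: measurable_funTS.
- apply/disj_setPS => x []/=; rewrite !in_itv/= andbT => x0.
  by rewrite leNgt x0.
rewrite integral_itv_bndo_bndc; last exact: measurable_funTS.
rewrite mule_natl mule2n; congr (_ + _).
by rewrite ge0_integration_by_substitution0//; apply: eq_integral => x _.
Qed.

(* Polar coordinates in disguise: [y = |x| t] and then [x = z / sqrt (1 + t^2)]. *)
Lemma integral_radial (g : R -> \bar R) : measurable_fun setT g ->
  (forall w, 0 <= g w) ->
  \int[mu]_x \int[mu]_y g (x ^+ 2 + y ^+ 2)%R =
  \int[mu]_t ((1 + t ^+ 2)^-1)%:E * \int[mu]_z (`|z|%:E * g (z ^+ 2)%R).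
Proof.
move=> mg g0.
have mq : measurable_fun [set: R * R]
    (fun z : R * R => g (z.1 ^+ 2 + z.2 ^+ 2)%R).
  by apply: measurableT_comp => //; apply: measurable_funD; apply: measurable_funX.
have mp : measurable_fun [set: R * R]
    (fun z : R * R => `|z.1|%:E * g (z.1 ^+ 2 * (1 + z.2 ^+ 2))%R).
  apply: emeasurable_funM.
    by apply/measurable_EFinP; apply: measurableT_comp.
  apply: measurableT_comp => //; apply: measurable_funM.
    by apply: measurable_funX.
  by apply: measurable_funD => //; apply: measurable_funX.
have p0 (z : R * R) : 0 <= `|z.1|%:E * g (z.1 ^+ 2 * (1 + z.2 ^+ 2))%R.
  by rewrite mule_ge0.
(* Substituting [y = |x| t] in the inner integral requires [x != 0], which excludes only a null
   set. *)
transitivity (\int[mu]_x \int[mu]_t (`|x|%:E * g (x ^+ 2 * (1 + t ^+ 2))%R)).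
  apply: ae_eq_integral => //.
  - exact: (measurable_fun_fubini_tonelli_F (m2 := mu) _ mq (fun z => g0 _)).
  - exact: (measurable_fun_fubini_tonelli_F (m2 := mu) _ mp p0).
  - exists [set 0%R]; split => //; first exact: lebesgue_measure_set1.
    move=> x /= /not_implyP[_ h]; apply: contrapT => x0; apply: h.
    have ax : (0 < `|x|)%R by rewrite normr_gt0; exact/eqP.
    rewrite (ge0_integral_scale _ (fun y => g (x ^+ 2 + y ^+ 2)%R) ax)//; last first.
      by apply: measurableT_comp => //; apply: measurable_funD => //;
         apply: measurable_funX.
    rewrite ge0_integralZl//.
      by congr (_ * _); apply: eq_integral => t _; congr (g _);
         rewrite exprMn real_normK ?num_real// mulrDr mulr1.
    apply: measurableT_comp => //; apply: measurable_funM => //.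
    by apply: measurable_funD => //; apply: measurable_funX.
rewrite [LHS](@fubini_tonelli _ _ _ _ _ mu mu _ mp p0)/=.
rewrite -ge0_integralZr//; last 3 first.
- apply/measurable_EFinP.
  exact: continuous_measurable_fun (@continuous_oneDsqrV R).
- by move=> t _; rewrite lee_fin invr_ge0 addr_ge0 ?sqr_ge0.
- by apply: integral_ge0 => z _; rewrite mule_ge0.
apply: eq_integral => t _.
have t1 : (0 < 1 + t ^+ 2)%R by rewrite ltr_pwDl ?sqr_ge0.
(* The substitution [x = k z] contributes one factor [k] and the weight [|x|] another; together they
   give [(1 + t ^+ 2)^-1]. *)
set k : R := ((Num.sqrt (1 + t ^+ 2))^-1)%R.
have k0 : (0 < k)%R by rewrite invr_gt0 sqrtr_gt0.
have k2 : (k ^+ 2 = (1 + t ^+ 2)^-1)%R by rewrite exprVn sqr_sqrtr ?(ltW t1).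
have k21 : (k ^+ 2 * (1 + t ^+ 2) = 1)%R by rewrite k2 mulVf ?gt_eqF.
have mzg : measurable_fun setT (fun z : R => `|z|%:E * g (z ^+ 2)%R).
  apply: emeasurable_funM; first by apply/measurable_EFinP; exact: normr_measurable.
  by apply: measurableT_comp => //; exact: exprn_measurable.
rewrite (ge0_integral_scale _ (fun x => `|x|%:E * g (x ^+ 2 * (1 + t ^+ 2))%R) k0)//; last 2 first.
- apply: emeasurable_funM; first by apply/measurable_EFinP; exact: normr_measurable.
  apply: measurableT_comp => //; exact: measurable_funM.
- by move=> x; rewrite mule_ge0.
rewrite -k2 expr2 EFinM -muleA; congr (_ * _).
rewrite -[RHS]ge0_integralZl//; last 2 first.
- by move=> z _; rewrite mule_ge0.
- by rewrite lee_fin ltW.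
apply: eq_integral => z _; rewrite muleA -EFinM normrM (gtr0_norm k0); congr (_ * g _).
by rewrite exprMn mulrAC k21 mul1r.
Qed.

End lebesgue_symmetries.

Section gaussian_tail.
Context {R : realType}.
Notation mu := (@lebesgue_measure R).
Local Open Scope ring_scope.

(** Up to a constant, the joint density of two independent centred Gaussians of variance [s / 2] at
    squared modulus [w], cut off below [r]. *)
Let tail (s r w : R) : R := if r <= w then expR (- w / s) else 0.

Let tail_ge0 s r w : 0 <= tail s r w.
Proof. by rewrite /tail; case: ifP => // _; exact: expR_ge0. Qed.

Let measurable_tail s r : measurable_fun setT (tail s r).
Proof.
apply: measurable_fun_ifT => //; first exact: measurable_fun_ler.
by apply: measurableT_comp => //; apply: measurable_funM => //; exact: measurableT_comp.
Qed.

Let integral_tail (s r : R) : 0 < s -> 0 <= r ->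
  (\int[mu]_z (`|z|%:E * (tail s r (z ^+ 2))%:E) = (s * expR (- r / s))%:E)%E.
Proof.
move=> s0 r0.
rewrite ge0_even_integralT; last 3 first.
- apply: emeasurable_funM; first by apply/measurable_EFinP; exact: normr_measurable.
  apply/measurable_EFinP; apply: (@measurableT_comp _ _ _ _ _ _ (tail s r)); [exact: measurable_tail|by []].
- by move=> x; rewrite mule_ge0 ?lee_fin.
- by move=> x; rewrite normrN sqrrN.
transitivity (2%:E * \int[mu]_(z in `[Num.sqrt r, +oo[) (z * expR (- z ^+ 2 / s))%:E)%E.
  congr (_ * _)%E.
  rewrite [RHS]integral_mkcond [LHS]integral_mkcond.
  apply: eq_integral => z _; rewrite !patchE !mem_setE !in_itv/= !andbT.
  case: (lerP 0 z) => z0; last first.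
    by rewrite ifF//; apply/negbTE; rewrite -ltNge (lt_le_trans z0)// sqrtr_ge0.
  have -> : (Num.sqrt r <= z) = (r <= z ^+ 2).
    by rewrite -{1}(ger0_norm z0) -sqrtr_sqr ler_sqrt// sqr_ge0.
  by rewrite /tail ger0_norm// -EFinM; case: ifP => //; rewrite mulr0.
have dF (x : R) : is_derive x 1 (fun z => - (s / 2) * expR (- z ^+ 2 / s))
    (x * expR (- x ^+ 2 / s)).
  apply: is_derive_eq; rewrite /GRing.scale/= !mulr0 ?add0r ?addr0; field.
  by rewrite gt_eqF.
have cF (x : R) : {for x, continuous (fun z : R => - (s / 2) * expR (- z ^+ 2 / s))}.
  by apply/differentiable_continuous/derivable1_diffP; exact: (@ex_derive _ _ _ _ _ _ _ (dF x)).
rewrite (@ge0_continuous_FTC2y _ _ (fun z => - (s / 2) * expR (- z ^+ 2 / s)) _ 0)//.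
- rewrite sqr_sqrtr// -EFinB -EFinM; congr _%:E; by field.
- by move=> x rx; apply: mulr_ge0; [exact: le_trans (sqrtr_ge0 _) rx|exact: expR_ge0].
- apply: continuous_subspaceT => x.
  apply: (@continuousM _ _ id) => //.
  apply: continuous_comp; last exact: continuous_expR.
  by apply: differentiable_continuous.
- rewrite -[X in _ --> X](mulr0 (- (s / 2))); apply: cvgMr.
  rewrite (_ : (fun x => expR (- x ^+ 2 / s)) = (fun z => expR (- z)) \o (fun z => z ^+ 2 / s)); last first.
    by apply/funext => x /=; rewrite mulNr.
  apply: (@cvg_comp _ _ _ _ _ _ (pinfty_nbhs R)); last exact: cvgr_expR.
  by apply/gt0_cvgMly; [rewrite invr_gt0|exact: cvgr_expr2].
- exact: cvg_at_right_filter (cF _).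
- by move=> x _; rewrite derive1E derive_val.
Qed.

(** The joint density depends only on the squared modulus, so [integral_radial] separates a factor
    [K], the same for all [r], from an exponential tail. Thus the squared modulus is exponential
    with mean [s]. *)
Lemma normal_prob2_tail (s r : R) : 0 < s -> 0 <= r ->
  (normal_prob (0 : R) (Num.sqrt (s / 2)) \x
   normal_prob (0 : R) (Num.sqrt (s / 2)))%E
    [set z | r <= z.1 ^+ 2 + z.2 ^+ 2] = (expR (- r / s))%:E.
Proof.
move=> s0.
set sd := Num.sqrt (s / 2).
have sd0 : sd != 0 by rewrite gt_eqF// sqrtr_gt0 divr_gt0.
have sdE : sd ^+ 2 *+ 2 = s.
  by rewrite sqr_sqrtr ?divr_ge0 ?ltW// -mulr_natr divfK.
pose c := normal_peak sd; have c0 : 0 <= c := normal_peak_ge0 sd.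
pose K := (\int[mu]_t ((1 + t ^+ 2)^-1)%:E)%E.
have main q : 0 <= q -> (normal_prob (0 : R) sd \x normal_prob (0 : R) sd)%E
    [set z | q <= z.1 ^+ 2 + z.2 ^+ 2] = (K * (c * c * s * expR (- q / s))%:E)%E.
  move=> q0; set A := [set z | _].
  have mA : measurable A.
    have mf : measurable_fun setT (fun z : R * R => z.1 ^+ 2 + z.2 ^+ 2).
      by apply: measurable_funD; exact: measurable_funX.
    have := mf measurableT _ (measurable_itv `[q, +oo[).
    by rewrite setTI set_itvcy.
  rewrite /product_measure1 /=.
  rewrite (@ge0_integral_density _ _ _ _ mu _ (integrable_normal_pdf 0 sd))//; last first.
    exact: measurable_fun_xsection.
  transitivity (\int[mu]_x \int[mu]_y ((c * c)%:E * (tail s q (x ^+ 2 + y ^+ 2))%:E))%E.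
    apply: eq_integral => x _.
    rewrite /= /normal_prob -ge0_integralZr//; last 4 first.
    - exact: measurable_xsection.
    - by apply/measurable_EFinP/measurable_funTS; exact: measurable_normal_pdf.
    - by move=> y _; rewrite lee_fin normal_pdf_ge0.
    - by rewrite lee_fin normal_pdf_ge0.
    rewrite integral_mkcond; apply: eq_integral => y _.
    rewrite patchE mem_xsection /tail; have -> : ((x, y) \in A) = (q <= x ^+ 2 + y ^+ 2).
      by rewrite /A; apply/idP/idP; rewrite inE.
    case: ifP => _; last by rewrite mule0.
    rewrite -!EFinM; congr _%:E; rewrite !normal_pdfE// /normal_fun sdE.
    rewrite !subr0 !mulNr mulrDl opprD expRD -/c; ring.
  rewrite [LHS](integral_radial (fun w => (c * c)%:E * (tail s q w)%:E)%E)//; last 2 first.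
    - by apply: emeasurable_funM => //; apply/measurable_EFinP; exact: measurable_tail.
    - by move=> w; rewrite mule_ge0 ?lee_fin ?mulr_ge0.
  congr (_ * _)%E; rewrite -mulrA [RHS]EFinM -integral_tail// -ge0_integralZl//; last 3 first.
  - apply: emeasurable_funM; first by apply/measurable_EFinP; exact: normr_measurable.
    by apply/measurable_EFinP; apply: (@measurableT_comp _ _ _ _ _ _ (tail s q)).
  - by move=> x _; rewrite mule_ge0 ?lee_fin.
  - by rewrite lee_fin mulr_ge0.
  by apply: eq_integral => z _; rewrite muleCA.
(* The constant is found from the case [q = 0], where the total mass is 1. *)
have K1 : (K * (c * c * s)%:E = 1)%E.
  have := main 0 (lexx _); rewrite oppr0 mul0r expR0 mulr1 => <-.
  rewrite (_ : [set z | _] = setT); first exact: probability_setT.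
  by apply/seteqP; split => // z _ /=; rewrite addr_ge0 ?sqr_ge0.
by move=> r0; rewrite main// EFinM muleA K1 mul1e.
Qed.

End gaussian_tail.

(** * Partial sums of independent variables *)

Section independence.
Context {d d1 d2} {T : measurableType d} {E1 : measurableType d1}
  {E2 : measurableType d2} {R : realType} (P : probability T R).
Local Open Scope ereal_scope.

(** The law of [(U, V)] under [P] conditioned on [E] agrees with the product of the marginals on
    rectangles, hence everywhere by uniqueness of the product measure. The event [E] is there to
    carry conditions on further variables. *)
Lemma independent_joint_law (U : {mfun T >-> E1}) (V : {mfun T >-> E2})
    (E : set T) : measurable E ->
  (forall A B, measurable A -> measurable B ->
    P (U @^-1` A `&` (V @^-1` B `&` E)) = P (U @^-1` A) * (P (V @^-1` B) * P E)) ->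
  forall M, measurable M ->
    P ([set t | M (U t, V t)] `&` E) =
    (distribution P U \x distribution P V) M * P E.
Proof.
move=> mE indep M mM.
have mUV : measurable_fun setT (fun t => (U t, V t)).
  by apply/measurable_fun_pair.
(* Conditioning divides by [P E], so a null [E] is treated apart: both sides are then 0. *)
have [PE0|PE0] := eqVneq (P E) 0.
  rewrite PE0 mule0; apply/eqP; rewrite -measure_le0 -PE0 le_measure ?inE//.
  apply: measurableI => //; rewrite -[X in measurable X]setTI; exact: mUV.
have Pfin : P E \is a fin_num by exact: fin_num_measure.
have e0 : (0 < fine (P E))%R.
  by rewrite fine_gt0// lt0e PE0 measure_ge0 ltey_eq Pfin.
have c0 : (0 <= (fine (P E))^-1)%R by rewrite invr_ge0 ltW.
have cP : ((fine (P E))^-1)%:E * P E = 1.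
  by rewrite -{2}(fineK Pfin) -EFinM mulVf ?gt_eqF.
pose m := mscale (NngNum c0) (pushforward_measure (mrestr P mE) mUV).
rewrite (@product_measure_unique _ _ _ _ _ _ _ m)//.
  rewrite /m /= /mscale /= /pushforward /mrestr /=.
  by rewrite muleAC cP mul1e.
move=> A B mA mB.
rewrite /m /= /mscale /= /pushforward /mrestr /= /distribution/= /pushforward.
rewrite (_ : _ `&` E = U @^-1` A `&` (V @^-1` B `&` E)); last by rewrite setIA.
by rewrite indep// muleCA [X in _ * X]muleCA cP mule1.
Qed.

End independence.

Section partial_sums.
Context {d d'} {T : measurableType d} {E : measurableType d'} {R : realType}.
Variables (P : probability T R) (D : nat) (V : nat -> T -> E) (g : nat -> E -> \bar R).
Hypothesis mV : forall i, (1 <= i <= D)%N -> measurable_fun setT (V i).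
Hypothesis mg : forall i, (1 <= i <= D)%N -> measurable_fun setT (g i).
Hypothesis indV : forall F : seq nat, uniq F ->
  [set` F] `<=` [set i : nat | (1 <= i <= D)%N] ->
  forall A : nat -> set E, (forall i, measurable (A i)) ->
  P (\bigcap_(i in [set` F]) (V i @^-1` A i)) = (\prod_(i <- F) P (V i @^-1` A i))%E.

Definition psum (k : nat) (t : T) : \bar R := (\sum_(1 <= i < k.+1) g i (V i t))%E.

Lemma psumS k t : psum k.+1 t = (psum k t + g k.+1 (V k.+1 t))%E.
Proof. by rewrite /psum big_nat_recr. Qed.

Lemma measurable_psum k : (k <= D)%N -> measurable_fun setT (psum k).
Proof.
elim: k => [_|k IH kD].
  by rewrite (_ : psum 0 = cst 0%E)//; apply/funext => t; rewrite /psum big_geq.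
rewrite (_ : psum k.+1 = fun t => (psum k t + g k.+1 (V k.+1 t))%E); last first.
  by apply/funext => t; rewrite psumS.
apply: emeasurable_funD; first exact/IH/ltnW.
by apply: measurableT_comp; [exact: mg|exact: mV].
Qed.

Let box (F : seq nat) (A : nat -> set E) := \bigcap_(i in [set` F]) (V i @^-1` A i).

(** Invariant of the induction on [k]: the partial sum is independent of every box in the later
    variables. Keeping all later variables in the invariant is what lets the next one be absorbed
    into the sum. *)
Let box_indep k := forall F : seq nat, uniq F ->
  [set` F] `<=` [set i : nat | (k < i <= D)%N] ->
  forall A : nat -> set E, (forall i, measurable (A i)) ->
  forall B, measurable B ->
  P (psum k @^-1` B `&` box F A) = (P (psum k @^-1` B) * P (box F A))%E.

Let rect_indep k : (k < D)%N -> box_indep k -> forall F : seq nat, uniq F ->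
  [set` F] `<=` [set i : nat | (k.+1 < i <= D)%N] ->
  forall A : nat -> set E, (forall i, measurable (A i)) ->
  forall A0 B0, measurable A0 -> measurable B0 ->
    P (psum k @^-1` A0 `&` (V k.+1 @^-1` B0 `&` box F A)) =
    (P (psum k @^-1` A0) * (P (V k.+1 @^-1` B0) * P (box F A)))%E.
Proof.
move=> kD IH F uF FD A mA A0 B0 mA0 mB0.
have kF : k.+1 \notin F by apply/negP => /FD/=; rewrite ltnn.
(* Adding the index [k.+1] with side [B0] merges the condition on [V k.+1] with the box, so that
   [IH] applies to the longer list. *)
pose A' i := if i == k.+1 then B0 else A i.
have mA' i : measurable (A' i) by rewrite /A'; case: ifP.
have e : V k.+1 @^-1` B0 `&` box F A = box (k.+1 :: F) A'.
  apply/seteqP; split => t /=.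
    move=> [Vt Ft] i /=; rewrite inE /A'; case: eqVneq => [->//|_] /= iF; exact: Ft.
  move=> h; split; first by have := h k.+1; rewrite /= inE eqxx /A' eqxx; exact.
  move=> i /= iF; have := h i; rewrite /= inE iF orbT /A' ifF; first exact.
  by apply/negbTE; apply: contraNneq kF => <-.
have pos i : (k.+1 < i <= D)%N -> (0 < i <= D)%N.
  by case/andP => /(leq_ltn_trans (leq0n _)) -> ->.
rewrite e IH//; last 2 first.
- by rewrite /= kF.
- move=> i /=; rewrite inE => /predU1P[->|/FD/=]; first by rewrite ltnSn.
  by case/andP => /ltnW -> ->.
congr (_ * _)%E; rewrite /box indV//; last 2 first.
- by rewrite /= kF.
- by move=> i /=; rewrite inE => /predU1P[->|/FD/=]; [|exact: pos].
rewrite big_cons {1}/A' eqxx indV//; last by move=> i /FD/=; exact: pos.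
congr (_ * _)%E; apply: eq_big_seq => i iF; rewrite /A' ifF//; apply/negbTE.
by apply: contraNneq kF => <-.
Qed.

Let joint_law k (kD : (k < D)%N) (U : {mfun T >-> \bar R}) (V' : {mfun T >-> E}) :
  box_indep k -> U = psum k :> (T -> \bar R) -> V' = V k.+1 :> (T -> E) ->
  forall M : set (\bar R * E), measurable M ->
  P [set t | M (psum k t, V k.+1 t)] = (distribution P U \x distribution P V')%E M.
Proof.
move=> IH Ue Ve M mM.
(* The box over the empty list is the sure event, which turns the three-fold factorisation into
   independence of the pair. *)
have box0 : box [::] (fun=> setT) = setT by apply/seteqP; split.
have := independent_joint_law P U V' setT measurableT _ M mM.
rewrite setIT probability_setT mule1 Ue Ve; apply => A B mA mB.
by rewrite -box0 -[1%E](probability_setT P) -box0 rect_indep.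
Qed.

Let psum_box_indep k : (k <= D)%N -> box_indep k.
Proof.
elim: k => [_ F uF FD A mA B mB|k IH kD F uF FD A mA B mB].
  have -> : psum 0 = cst 0%E by apply/funext => t; rewrite /psum big_geq.
  rewrite preimage_cst; case: ifPn => _.
    by rewrite setTI probability_setT mul1e.
  by rewrite set0I measure0 mul0e.
have {}IH := IH (ltnW kD).
have kD' : (1 <= k.+1 <= D)%N by [].
have mE : measurable (box F A).
  apply: fin_bigcap_measurable => // i iF.
  rewrite -[X in measurable X]setTI; apply: mV => //.
  by have /= /andP[/(leq_ltn_trans (leq0n _)) -> ->] := FD _ iF.
pose U : {mfun T >-> \bar R} :=
  HB.pack (psum k) (isMeasurableFun.Build _ _ _ _ _ (measurable_psum k (ltnW kD))).
pose V' : {mfun T >-> E} := HB.pack (V k.+1) (isMeasurableFun.Build _ _ _ _ _ (mV _ kD')).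
(* The next partial sum is a measurable function of the pair [(psum k, V k.+1)], so an event about
   it is an event [M] about the pair, whose joint law with the later box factorises. *)
pose M := [set z : \bar R * E | B (z.1 + g k.+1 z.2)%E].
have mM : measurable M.
  have mf : measurable_fun setT (fun z : \bar R * E => (z.1 + g k.+1 z.2)%E).
    apply: emeasurable_funD => //; apply: measurableT_comp => //; exact: mg.
  by rewrite -[X in measurable X]setTI; exact: mf.
have -> : psum k.+1 @^-1` B = [set t | M (psum k t, V k.+1 t)].
  by apply/seteqP; split => t; rewrite /M/= psumS.
rewrite (joint_law k kD U V')//.
exact: (independent_joint_law P U V' (box F A) mE (rect_indep k kD IH F uF FD A mA)).
Qed.

(** By independence the pair has a product law; integrating it with the last variable outermost
    expresses conditioning on [V k.+1]. *)
Lemma psum_condition k (M : set (\bar R * E)) : (k < D)%N -> measurable M ->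
  P [set t | M (psum k t, V k.+1 t)] =
  (\int[P]_t P [set s | M (psum k s, V k.+1 t)])%E.
Proof.
move=> kD mM; have kD' : (1 <= k.+1 <= D)%N by [].
pose U : {mfun T >-> \bar R} :=
  HB.pack (psum k) (isMeasurableFun.Build _ _ _ _ _ (measurable_psum k (ltnW kD))).
pose V' : {mfun T >-> E} := HB.pack (V k.+1) (isMeasurableFun.Build _ _ _ _ _ (mV _ kD')).
rewrite (joint_law k kD U V')//; last exact/psum_box_indep/ltnW.
rewrite (@product_measure_unique _ _ _ _ _ _ _ (distribution P U \x^ distribution P V')%E)//; last first.
  by move=> A B mA mB; exact: product_measure2E.
transitivity (\int[distribution P V']_y (distribution P U \o ysection M) y)%E => //.
rewrite ge0_integral_distribution//; last exact: measurable_fun_ysection.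
apply: eq_integral => t _ /=; rewrite /distribution /pushforward; congr (P _).
by apply/seteqP; split => s /=; rewrite /ysection/= inE.
Qed.

Lemma measurable_psum_section k (M : set (\bar R * E)) : (k < D)%N -> measurable M ->
  measurable_fun setT (fun t => P [set s | M (psum k s, V k.+1 t)]).
Proof.
move=> kD mM; have kD' : (1 <= k.+1 <= D)%N by [].
pose U : {mfun T >-> \bar R} :=
  HB.pack (psum k) (isMeasurableFun.Build _ _ _ _ _ (measurable_psum k (ltnW kD))).
rewrite (_ : (fun t => _) = (distribution P U \o ysection M) \o V k.+1); last first.
  apply/funext => t /=; rewrite /distribution /pushforward; congr (P _).
  by apply/seteqP; split => s /=; rewrite /ysection/= inE.
apply: measurableT_comp; last exact: mV.
exact: measurable_fun_ysection.
Qed.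

End partial_sums.

(** * The objective defining J *)

Section objective.
Context {R : realType}.
Implicit Types (A S t x : R).

(* With [a = e^A], [v = a^(1+t)] and hence [u = a^(1+1/t)], the objective becomes
   [- ln (1 - e^(- S (u - a))) / (v - a)]. *)
Definition gap A t : R := expR A * (expR (A * t) - 1).

Definition obj S A t : R := - ln (1 - expR (- (S * gap A t^-1))) / gap A t.

Lemma gap_gt0 A t : 0 < A -> 0 < t -> 0 < gap A t.
Proof. by move=> A0 t0; rewrite mulr_gt0 ?expR_gt0// subr_gt0 expR_gt1 mulr_gt0. Qed.

Lemma gap_surj A x : 0 < A -> 0 < x -> exists2 t, 0 < t & gap A t = x.
Proof.
move=> A0 x0; have e0 : 0 < x / expR A by rewrite divr_gt0 ?expR_gt0.
exists (ln (1 + x / expR A) / A).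
  by rewrite divr_gt0// ln_gt0// ltrDl.
rewrite /gap mulrCA mulfV ?gt_eqF// mulr1 lnK ?posrE ?addr_gt0//.
by rewrite addrAC subrr add0r mulrCA mulfV ?mulr1// gt_eqF ?expR_gt0.
Qed.

Lemma ler_gap A A' t t' : 0 < A -> A <= A' -> 0 < t -> t <= t' -> gap A t <= gap A' t'.
Proof.
move=> A0 AA t0 tt; apply: ler_pM; rewrite ?expR_ge0 ?ler_expR//.
  by rewrite subr_ge0 -expR0 ler_expR mulr_ge0 ?ltW.
by rewrite lerD2r ler_expR; apply: ler_pM => //; exact: ltW.
Qed.

(** Since [gap] increases in both arguments, equal gaps with [A <= A'] force [t' <= t]. This is the
    comparison of a deadline with a shorter one. *)
Lemma gap_inv_mono A A' t t' : 0 < A -> A <= A' -> 0 < t -> 0 < t' ->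
  gap A t = gap A' t' -> gap A t^-1 <= gap A' t'^-1.
Proof.
move=> A0 AA t0 t'0 e; apply: ler_gap; rewrite ?invr_gt0// lef_pV2 ?posrE//.
rewrite leNgt; apply/negP => tt; have : gap A t < gap A' t'; last by rewrite e ltxx.
apply: (le_lt_trans (ler_gap _ _ _ _ A0 AA t0 (lexx t))).
rewrite ltr_pM2l ?expR_gt0// ltrD2r ltr_expR ltr_pM2l//.
exact: lt_le_trans AA.
Qed.

(** From [1 + x <= expR x] one gets [(1 - expR (- x))^-1 <= 1 + x^-1]; then
    [ln (1 + x^-1) <= x^-1]. *)
Lemma ln1BexpRN_le x : 0 < x -> - ln (1 - expR (- x)) <= x^-1.
Proof.
move=> x0; have e1 : 0 < 1 - expR (- x) by rewrite subr_gt0 expR_lt1 oppr_lt0.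
rewrite -lnV ?posrE//; apply: (@le_trans _ _ (ln (1 + x^-1))); last first.
  by rewrite le_ln1Dx// (lt_trans _ (_ : 0 < x^-1)) ?invr_gt0// ltrN10.
have p1 : 0 < 1 + x^-1 by rewrite addr_gt0 ?invr_gt0.
rewrite ler_ln ?posrE ?invr_gt0//.
rewrite -[leRHS]invrK lef_pV2 ?posrE ?invr_gt0//.
have := expR_ge1Dx x; rewrite expRN => h.
have h1 : (expR x)^-1 <= (1 + x)^-1 by rewrite lef_pV2 ?posrE ?expR_gt0 ?addr_gt0.
have -> : (1 + x^-1)^-1 = 1 - (1 + x)^-1 by field; rewrite !gt_eqF ?addr_gt0.
by rewrite lerD2l lerN2.
Qed.

(** The factor in [t] is bounded below quadratically and the factor in [t^-1] linearly, so the
    product grows at least like [t]. By symmetry, exchanging [t] and [t^-1] gives growth at the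
    other end. *)
Lemma gap_lb A t : 0 < A -> 0 < t -> A ^+ 3 / 2 * t <= gap A t * gap A t^-1.
Proof.
move=> A0 t0.
have At0 : 0 <= A * t by rewrite mulr_ge0 ?ltW.
have h1 := expR_ge1Dxn 1 At0.
have h2 := expR_ge1Dx (A / t).
have e1 : 1 <= expR A by rewrite -expR0 ler_expR ltW.
have -> : A ^+ 3 / 2 * t = (A * t) ^+ 2 / 2 * (A / t) by field; rewrite gt_eqF.
apply: ler_pM.
- by rewrite divr_ge0 ?sqr_ge0.
- by rewrite divr_ge0 ?ltW.
- rewrite -[leLHS]mul1r; apply: ler_pM => //; first by rewrite divr_ge0 ?sqr_ge0.
  by rewrite lerBrDl.
- rewrite -[leLHS]mul1r; apply: ler_pM => //; first by rewrite divr_ge0 ?ltW.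
  by rewrite lerBrDl.
Qed.

Lemma obj_gt0 S A t : 0 < S -> 0 < A -> 0 < t -> 0 < obj S A t.
Proof.
move=> S0 A0 t0; have g0 : 0 < S * gap A t^-1 by rewrite mulr_gt0// gap_gt0 ?invr_gt0.
rewrite divr_gt0 ?gap_gt0// oppr_gt0 ln_lt0// subr_gt0 expR_lt1 oppr_lt0 g0/=.
by rewrite ltrBlDr ltrDl expR_gt0.
Qed.

Lemma obj_le_gap S A t : 0 < S -> 0 < A -> 0 < t ->
  obj S A t <= (S * (gap A t * gap A t^-1))^-1.
Proof.
move=> S0 A0 t0; have t'0 : 0 < t^-1 by rewrite invr_gt0.
have g0 := gap_gt0 _ _ A0 t0; have g'0 := gap_gt0 _ _ A0 t'0.
rewrite /obj ler_pdivrMr//.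
have -> : (S * (gap A t * gap A t^-1))^-1 * gap A t = (S * gap A t^-1)^-1.
  by field; rewrite !gt_eqF.
by apply: ln1BexpRN_le; rewrite mulr_gt0.
Qed.

Lemma obj_le S A t : 0 < S -> 0 < A -> 0 < t ->
  obj S A t <= 2 / (S * A ^+ 3) / t.
Proof.
move=> S0 A0 t0; apply: le_trans (obj_le_gap _ _ _ S0 A0 t0) _.
have -> : 2 / (S * A ^+ 3) / t = (S * (A ^+ 3 / 2 * t))^-1.
  by field; rewrite !gt_eqF.
have p0 : 0 < A ^+ 3 / 2 * t by rewrite mulr_gt0// divr_gt0// exprn_gt0.
have lb := gap_lb _ _ A0 t0.
rewrite lef_pV2 ?posrE ?ler_pM2l//; apply: mulr_gt0 => //.
exact: lt_le_trans lb.
Qed.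

Lemma obj_le_inv S A t : 0 < S -> 0 < A -> 0 < t ->
  obj S A t <= 2 / (S * A ^+ 3) * t.
Proof.
move=> S0 A0 t0; apply: le_trans (obj_le_gap _ _ _ S0 A0 t0) _.
have t'0 : 0 < t^-1 by rewrite invr_gt0.
have -> : 2 / (S * A ^+ 3) * t = (S * (A ^+ 3 / 2 * t^-1))^-1.
  by field; rewrite !gt_eqF.
have p0 : 0 < A ^+ 3 / 2 * t^-1 by rewrite mulr_gt0// divr_gt0// exprn_gt0.
have := gap_lb _ _ A0 t'0; rewrite invrK [gap A t^-1 * _]mulrC => lb.
rewrite lef_pV2 ?posrE ?ler_pM2l//; apply: mulr_gt0 => //.
exact: lt_le_trans lb.
Qed.

Lemma continuous_obj S A t : 0 < S -> 0 < A -> 0 < t -> {for t, continuous (obj S A)}.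
Proof.
move=> S0 A0 t0.
have cgap x : {for x, continuous (gap A)}.
  apply: continuousM; first exact: cst_continuous.
  apply: continuousB; last exact: cst_continuous.
  apply: continuous_comp; last exact: continuous_expR.
  by apply: continuousM => //; exact: cst_continuous.
apply: continuousM; last first.
  by apply: continuousV; [rewrite gt_eqF// gap_gt0|exact: cgap].
apply: continuousN; apply: continuous_comp; last first.
  apply: continuous_ln; rewrite subr_gt0 expR_lt1 oppr_lt0 mulr_gt0// gap_gt0//.
  by rewrite invr_gt0.
apply: continuousB; first exact: cst_continuous.
apply: continuous_comp; last exact: continuous_expR.
apply: continuousN; apply: continuousM; first exact: cst_continuous.
apply: continuous_comp; last exact: cgap.
by apply: continuousV => //; rewrite gt_eqF.
Qed.

Lemma obj_max S A : 0 < S -> 0 < A ->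
  exists2 t0, 0 < t0 & forall t, 0 < t -> obj S A t <= obj S A t0.
Proof.
move=> S0 A0.
pose C := 2 / (S * A ^+ 3); have C0 : 0 < C by rewrite divr_gt0// mulr_gt0// exprn_gt0.
have j0 := obj_gt0 _ _ _ S0 A0 ltr01.
(* [K] is chosen so that the bounds [C / t] for [t > K] and [C * t] for [t < K^-1] are both at most
   the value at 1. As 1 lies in [[K^-1, K]], the maximum on this compact interval is global. *)
pose K := 1 + C / obj S A 1.
have K1 : 1 < K by rewrite ltrDl divr_gt0.
have K0 : 0 < K by exact: lt_trans K1.
have CK : C / K <= obj S A 1.
  rewrite ler_pdivrMr// mulrDr mulr1 mulrCA mulfV ?mulr1 ?gt_eqF// lerDr ltW//.
have KK : K^-1 <= K by rewrite (@le_trans _ _ 1)// ?ltW// invf_lt1.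
have [c cK cmax] : exists2 c, c \in `[K^-1, K] &
    forall t, t \in `[K^-1, K] -> obj S A t <= obj S A c.
  apply: EVT_max => //; apply: continuous_in_subspaceT => x.
  rewrite inE/= in_itv/= => /andP[Kx _]; apply: continuous_obj => //.
  by apply: lt_le_trans Kx; rewrite invr_gt0.
have c0 : 0 < c by move: cK; rewrite in_itv/= => /andP[+ _]; apply: lt_le_trans; rewrite invr_gt0.
have c1 : obj S A 1 <= obj S A c.
  by apply: cmax; rewrite in_itv/= invf_le1 ?ltW.
exists c => // t t0; have [tK|Kt] := lerP t K; last first.
  apply: le_trans c1; apply: le_trans CK; apply: le_trans (obj_le _ _ _ S0 A0 t0) _.
  by rewrite ler_pM2l// lef_pV2 ?posrE// ltW.
have [Kt|tK'] := lerP K^-1 t.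
  by apply: cmax; rewrite in_itv/= Kt.
apply: le_trans c1; apply: le_trans CK; apply: le_trans (obj_le_inv _ _ _ S0 A0 t0) _.
by rewrite ler_pM2l// ltW.
Qed.

(** At [A] itself the inequality is [obj S A s <= J] rearranged. For a larger [A'], take [s] with
    the same gap at [A]; passing from [A] to [A'] only decreases the left-hand side. *)
Lemma gap_tail_bound S A A' J t : 0 < S -> 0 < A -> A <= A' -> 0 < t ->
  (forall t, 0 < t -> obj S A t <= J) ->
  expR (- (S * gap A' t^-1)) <= 1 - expR (- (J * gap A' t)).
Proof.
move=> S0 A0 AA t0 hJ.
have A'0 : 0 < A' := lt_le_trans A0 AA.
have [s s0 es] := gap_surj A (gap A' t) A0 (gap_gt0 _ _ A'0 t0).
apply: (@le_trans _ _ (expR (- (S * gap A s^-1)))).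
  by rewrite ler_expR lerN2 ler_pM2l// gap_inv_mono.
rewrite -es lerBrDr addrC -lerBrDr.
have g0 : 0 < S * gap A s^-1 by rewrite mulr_gt0// gap_gt0 ?invr_gt0.
have e1 : 0 < 1 - expR (- (S * gap A s^-1)) by rewrite subr_gt0 expR_lt1 oppr_lt0.
rewrite -[leRHS]lnK ?posrE// ler_expR lerNl.
by have := hJ _ s0; rewrite /obj ler_pdivrMr// gap_gt0.
Qed.

End objective.

(** * The objective in [v] and its reparametrisation by [t] *)

Section objective_link.
Context {R : realType} (rho : nat -> R) (L : nat).
Implicit Types (y t v : R) (d : nat).

Lemma ln2_gt0 : 0 < ln 2 :> R.
Proof. by rewrite ln_gt0// ltr1n. Qed.

Lemma pow2E x : 2 `^ x = expR (x * ln 2) :> R.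
Proof. by rewrite /powR gt_eqF. Qed.

(** With [ln v = A * (1 + t)] and [A = ln 2 / y], the denominator [y * ln v - ln 2] is [ln 2 * t],
    so the second power of 2 becomes [expR (A + A / t)]. *)
Lemma Jobj_obj y d t : 0 < y -> 0 < t ->
  Jobj rho L y d (expR (ln 2 / y * (1 + t))) =
  obj (d.-1%:R * Gbar rho L d.-1) (ln 2 / y) t.
Proof.
move=> y0 t0; set A := ln 2 / y; have l2 := ln2_gt0.
rewrite /Jobj /obj /gap !pow2E expRK.
have -> : 1 / y * ln 2 = A by rewrite mul1r mulrC.
have -> : A * (1 + t) / (y * (A * (1 + t)) - ln 2) * ln 2 = A + A * t^-1.
  have -> : y * (A * (1 + t)) - ln 2 = ln 2 * t by rewrite /A; field; rewrite gt_eqF.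
  by field; rewrite !gt_eqF.
rewrite (mulrDr A) mulr1 !expRD.
set S := _ * Gbar _ _ _; set e := expR A; set f := expR (A * t); set g := expR (A / t).
have f1 : 1 < f by rewrite expR_gt1 mulr_gt0// divr_gt0.
have e0 : 0 < e by exact: expR_gt0.
have -> : S * (e - e * g) = - (S * (e * (g - 1))) by ring.
have -> : e - e * f = - (e * (f - 1)) by ring.
by rewrite div1r invrN mulrC mulrN mulNr.
Qed.

Lemma Jvalues_obj y d : 0 < y ->
  Jvalues rho L y d =
  [set obj (d.-1%:R * Gbar rho L d.-1) (ln 2 / y) t | t in [set t | 0 < t]].
Proof.
move=> y0; have A0 : 0 < ln 2 / y by rewrite divr_gt0// ln2_gt0.
have e : 2 `^ (1 / y) = expR (ln 2 / y) by rewrite pow2E mul1r mulrC.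
apply/seteqP; split => [_ [v /= av <-]|_ [t /= t0 <-]].
  rewrite e in av; have v0 : 0 < v by exact: lt_trans (expR_gt0 _) av.
  have t0 : 0 < ln v / (ln 2 / y) - 1.
    by rewrite subr_gt0 ltr_pdivlMr// mul1r -ltr_expR lnK.
  have ve : expR (ln 2 / y * (1 + (ln v / (ln 2 / y) - 1))) = v.
    by rewrite addrC subrK mulrCA mulfV ?gt_eqF// mulr1 lnK.
  exists (ln v / (ln 2 / y) - 1); first exact: t0.
  by rewrite -(Jobj_obj _ _ _ y0 t0) ve.
exists (expR (ln 2 / y * (1 + t))); last exact: Jobj_obj.
by rewrite /= e ltr_expR mulrDr mulr1 ltrDl mulr_gt0.
Qed.

Lemma J_spec y d : 0 < y -> 0 < d.-1%:R * Gbar rho L d.-1 ->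
  [/\ is_maximum (Jvalues rho L y d) (J rho L y d), 0 < J rho L y d &
   forall t, 0 < t ->
    obj (d.-1%:R * Gbar rho L d.-1) (ln 2 / y) t <= J rho L y d].
Proof.
move=> y0 S0; have A0 : 0 < ln 2 / y by rewrite divr_gt0// ln2_gt0.
have [t0 t00 tmax] := obj_max _ _ S0 A0.
set m := obj _ _ t0 in tmax.
have mm : is_maximum (Jvalues rho L y d) m.
  rewrite Jvalues_obj//; split; first by exists t0.
  by move=> _ [t /= t1 <-]; exact: tmax.
have -> : J rho L y d = m.
  apply/eqP; rewrite eq_le; apply/andP; split.
    by apply: ge_sup; [exists m; exact: mm.1|exact: mm.2].
  by apply: ub_le_sup; [exists m; exact: mm.2|exact: mm.1].
by split => //; exact: obj_gt0.
Qed.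

End objective_link.

(** * Transmission times *)

Section exponential_tail.
Context {d} {T : measurableType d} {R : realType} (P : probability T R).
Notation mu := (@lebesgue_measure R).

(** For [X > b], [1 - expR (- (j * (X - b)))] is the integral of [j * expR (- (j * (s - b)))] over
    [s] in [[b, X]]. Exchanging the integrals leaves only the tail of [X], an exponential of rate
    [G]. *)
Lemma integral_exponential_tail (G b j : R) (X : T -> R) :
  0 < G -> 0 <= b -> 0 < j -> measurable_fun setT X ->
  (forall s, 0 <= s -> P [set t | s <= X t] = (expR (- (G * s)))%:E) ->
  (\int[P]_t (if (b < X t)%R then (1 - expR (- (j * (X t - b)))) else 0)%:E <=
   (expR (- (G * b)) * (j / (j + G)))%:E)%E.
Proof.
move=> G0 b0 j0 mX tailX.
pose f (z : T * R) : \bar R :=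
  (if (b <= z.2) && (z.2 <= X z.1) then j * expR (- (j * (z.2 - b))) else 0)%:E.
have mf : measurable_fun setT f.
  apply/measurable_EFinP; apply: measurable_fun_ifT => //.
    apply: measurable_and; first exact: measurable_fun_ler.
    by apply: measurable_fun_ler => //; exact: measurableT_comp.
  apply: measurable_funM => //; apply: measurableT_comp => //.
  apply: measurableT_comp => //; apply: measurable_funM => //.
  exact: measurable_funB.
have f0 z : (0 <= f z)%E.
  by rewrite lee_fin; case: ifP => // _; rewrite mulr_ge0 ?expR_ge0// ltW.
have dF (x : R) : is_derive x 1 (fun s => - expR (- (j * (s - b))))
    (j * expR (- (j * (x - b)))).
  by apply: is_derive_eq; rewrite /GRing.scale/=; ring.
have cF (x : R) : {for x, continuous (fun s : R => - expR (- (j * (s - b))))}.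
  by apply/differentiable_continuous/derivable1_diffP; exact: (@ex_derive _ _ _ _ _ _ _ (dF x)).
apply: (@le_trans _ _ (\int[P]_t \int[mu]_s f (t, s))%E).
  apply: ge0_le_integral => //.
  - move=> t _; rewrite lee_fin; case: ifP => // bX.
    by rewrite subr_ge0 -expR0 ler_expR oppr_le0 mulr_ge0 ?subr_ge0// ltW.
  - apply/measurable_EFinP; apply: measurable_fun_ifT => //; first exact: measurable_fun_ltr.
    apply: measurable_funB => //; apply: measurableT_comp => //.
    apply: measurableT_comp => //; apply: measurable_funM => //.
    exact: measurable_funB.
  - exact: (measurable_fun_fubini_tonelli_F (m2 := mu) _ mf f0).
  - move=> t _; case: ifPn => [bX|_]; last exact: integral_ge0.
    have -> : (\int[mu]_s f (t, s) =
        \int[mu]_(s in `[b, X t]) (j * expR (- (j * (s - b))))%:E)%E.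
      rewrite [RHS]integral_mkcond; apply: eq_integral => s _.
      by rewrite patchE mem_setE in_itv/= /f/=; case: ifP.
    rewrite (@continuous_FTC2 _ _ (fun s => - expR (- (j * (s - b)))))//.
    - by rewrite subrr mulr0 oppr0 expR0 -EFinB opprK addrC.
    - apply: continuous_subspaceT => x.
      by apply/differentiable_continuous/derivable1_diffP; exact: ex_derive.
    - split; first by move=> x _; exact: (@ex_derive _ _ _ _ _ _ _ (dF x)).
      + exact: cvg_at_right_filter (cF _).
      + exact: cvg_at_left_filter (cF _).
    - by move=> x _; rewrite derive1E; exact: (@derive_val _ _ _ _ _ _ _ (dF x)).
rewrite (@fubini_tonelli _ _ _ _ _ P mu _ mf f0)/=.
(* Antiderivative of the product of the kernel and the tail: it vanishes at infinity, and [- Q b] is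
   the claimed bound. *)
pose Q (s : R) := - (j / (j + G)) * expR (- (j * (s - b)) - G * s).
have dQ (x : R) : is_derive x 1 Q (j * expR (- (j * (x - b))) * expR (- (G * x))).
  rewrite -mulrA -expRD; apply: is_derive_eq; rewrite /GRing.scale/=; field.
  by rewrite gt_eqF// addr_gt0.
have cQ (x : R) : {for x, continuous Q}.
  by apply/differentiable_continuous/derivable1_diffP; exact: (@ex_derive _ _ _ _ _ _ _ (dQ x)).
rewrite (_ : (\int[mu]_s _)%E = (\int[mu]_(s in `[b, +oo[)
    (j * expR (- (j * (s - b))) * expR (- (G * s)))%:E)%E); last first.
  rewrite [RHS]integral_mkcond; apply: eq_integral => s _.
  rewrite patchE mem_setE in_itv/= andbT /f/=; case: ifPn => bs /=; last first.
    exact: integral0.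
  have mXs : measurable [set t | s <= X t].
    have := mX measurableT _ (measurable_itv `[s, +oo[).
    by rewrite setTI set_itvcy.
  rewrite EFinM -tailX ?(le_trans b0)// -integral_cst// [RHS]integral_mkcond.
  apply: eq_integral => t _; rewrite patchE.
  have -> : (t \in [set t | s <= X t]) = (s <= X t) by apply/idP/idP; rewrite inE.
  by case: ifP.
rewrite (@ge0_continuous_FTC2y _ _ Q _ 0)//.
- by rewrite sub0e -EFinN lee_fin /Q subrr mulr0 oppr0 add0r mulNr opprK mulrC.
- by move=> x _; rewrite !mulr_ge0 ?expR_ge0// ltW.
- apply: continuous_subspaceT => x.
  by apply/differentiable_continuous/derivable1_diffP; exact: ex_derive.
- rewrite -[X in _ --> X](mulr0 (- (j / (j + G)) * expR (j * b))).
  rewrite (_ : Q = fun s => - (j / (j + G)) * expR (j * b) * expR (- ((j + G) * s))); last first.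
    by apply/funext => s; rewrite /Q -mulrA -expRD; congr (_ * expR _); ring.
  apply: cvgMr.
  rewrite (_ : (fun s => expR _) = (fun z => expR (- z)) \o (fun s => (j + G) * s))//.
  apply: (@cvg_comp _ _ _ _ _ _ (pinfty_nbhs R)); last exact: cvgr_expR.
  by apply: gt0_cvgMry => //; exact: addr_gt0.
- exact: cvg_at_right_filter (cQ _).
- by move=> x _; rewrite derive1E; exact: (@derive_val _ _ _ _ _ _ _ (dQ x)).
Qed.

End exponential_tail.

(** * Time per bit as a function of the signal-to-noise ratio *)

Section transmission_time.
Context {R : realType}.

Definition snr (r : R) (z : R * R) : R := r * (z.1 ^+ 2 + z.2 ^+ 2).

(** The function [Y] carried over to [R * R], where the laws and the independence of the estimates
    are stated. *)
Definition time (r : R) (z : R * R) : \bar R := ((log2 (1 + snr r z))%:E^-1)%E.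

Lemma snr_ge0 r z : 0 <= r -> 0 <= snr r z.
Proof. by move=> r0; rewrite mulr_ge0// addr_ge0// sqr_ge0. Qed.

Lemma measurable_snr r : measurable_fun setT (snr r).
Proof. by apply: measurable_funM => //; apply: measurable_funD; exact: measurable_funX. Qed.

Lemma Y_time (rho : nat -> R) d (h : R[i]) : Y rho d h = time (rho d) (ReIm h).
Proof.
rewrite /Y /time /snr /ReIm; case: h => a b /=.
by rewrite sqr_sqrtr// addr_ge0// sqr_ge0.
Qed.

Lemma timeE r z : 0 <= r ->
  time r z = if snr r z == 0 then +oo%E else (ln 2 / ln (1 + snr r z))%:E.
Proof.
move=> r0; rewrite /time /log2 inver mulf_eq0 invr_eq0 [ln 2 == 0]gt_eqF ?ln2_gt0// orbF.
have x0 := snr_ge0 r z r0.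
rewrite ln_eq0 ?ltr_pwDl// -subr_eq0 addrAC subrr add0r.
by case: ifP => // _; rewrite invfM invrK mulrC.
Qed.

Lemma time_gt0 r z : 0 <= r -> (0 < time r z)%E.
Proof.
move=> r0; rewrite timeE//; case: eqP => [_|/eqP x0]; first exact: ltry.
rewrite lte_fin divr_gt0 ?ln2_gt0// ln_gt0// ltrDl lt0r x0 snr_ge0//.
Qed.

(** Writing a deadline as [ln 2 / A] makes [expR A] equal to 2 to the power of its inverse, so that
    [expR A - 1] is the least SNR meeting it. *)
Lemma time_le r z (A : R) : 0 <= r -> 0 < A ->
  (time r z <= (ln 2 / A)%:E)%E = (expR A - 1 <= snr r z).
Proof.
move=> r0 A0; have x0 := snr_ge0 r z r0; rewrite timeE//; case: eqP => [->|/eqP x1].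
  by rewrite leye_eq/= subr_le0 -expR0 ler_expR leNgt A0.
have l0 : 0 < ln (1 + snr r z) by rewrite ln_gt0// ltrDl lt0r x1.
rewrite lee_fin ler_pM2l ?ln2_gt0// lef_pV2 ?posrE// lerBlDl.
by rewrite -[in RHS](lnK (x := 1 + snr r z)) ?posrE ?ltr_pwDl// ler_expR.
Qed.

Lemma time_ge r z (A : R) : 0 <= r -> 0 < A ->
  ((ln 2 / A)%:E <= time r z)%E = (snr r z <= expR A - 1).
Proof.
move=> r0 A0; have x0 := snr_ge0 r z r0; rewrite timeE//; case: eqP => [->|/eqP x1].
  by rewrite leey subr_ge0 -expR0 ler_expR ltW.
have l0 : 0 < ln (1 + snr r z) by rewrite ln_gt0// ltrDl lt0r x1.
rewrite lee_fin ler_pM2l ?ln2_gt0// lef_pV2 ?posrE// lerBrDl.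
by rewrite -[in RHS](lnK (x := 1 + snr r z)) ?posrE ?ltr_pwDl// ler_expR.
Qed.

Lemma measurable_time r : 0 <= r -> measurable_fun setT (time r).
Proof.
(* The quotient is written as a power with exponent -1, a measurable function of the logarithm. *)
move=> r0; rewrite (_ : time r = fun z => if snr r z == 0 then +oo%E
    else (ln 2 * (ln (1 + snr r z)) `^ (-1))%:E); last first.
  apply/funext => z; rewrite timeE//; case: ifP => // _.
  by rewrite powR_inv1// ln_ge0// lerDl snr_ge0.
have ms := measurable_snr r.
apply: measurable_fun_ifT => //; first exact: measurable_fun_eqr.
apply/measurable_EFinP; apply: measurable_funM => //.
apply: (@measurableT_comp _ _ _ _ _ _ (@powR R ^~ (-1))) => //.
apply: (@measurableT_comp _ _ _ _ _ _ (@ln R)) => //.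
exact: measurable_funD.
Qed.

End transmission_time.

(** * Exponential law of the signal-to-noise ratios *)

Section channel.
Context {R : realType} {disp : measure_display} {T : measurableType disp}.
Variables (P : probability T R) (rho : nat -> R) (L : nat).
Hypothesis hL : (1 <= L)%N.

Lemma power_gt0 d : 0 < rho d -> 0 < 1 - sigma2 rho L d.
Proof.
move=> r0; have L0 : 0 < rho d * L%:R by rewrite mulr_gt0// ltr0n.
by rewrite subr_gt0 /sigma2 div1r invf_lt1 ?addr_gt0// ltrDl.
Qed.

Lemma G_gt0 d : 0 < rho d -> 0 < G rho L d.
Proof. by move=> r0; rewrite /G divr_gt0// mulr_gt0// power_gt0. Qed.

(** The squared modulus is exponential with mean [1 - sigma2 rho L d]; multiplying by [rho d] gives
    mean [(G rho L d)^-1]. *)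
Lemma snr_tail d (h : T -> R[i]) : 0 < rho d ->
  is_CN P h (1 - sigma2 rho L d) -> forall s, 0 <= s ->
  P [set t | s <= snr (rho d) (ReIm (h t))] = (expR (- (G rho L d * s)))%:E.
Proof.
move=> r0 [_ hP] s s0; have p0 := power_gt0 d r0.
rewrite (_ : [set t | _] =
  [set t | [set z : R * R | s / rho d <= z.1 ^+ 2 + z.2 ^+ 2] (ReIm (h t))]); last first.
  by apply/seteqP; split => t /=; rewrite /snr ler_pdivrMr// mulrC.
rewrite hP.
  rewrite normal_prob2_tail ?divr_ge0 ?(ltW r0)//; congr (expR _)%:E.
  by rewrite /G; field; rewrite !gt_eqF.
have mf : measurable_fun setT (fun z : R * R => z.1 ^+ 2 + z.2 ^+ 2).
  by apply: measurable_funD; exact: measurable_funX.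
have := mf measurableT _ (measurable_itv `[s / rho d, +oo[).
by rewrite setTI set_itvcy.
Qed.

Lemma Gbar_sum d : (0 < d)%N -> d%:R * Gbar rho L d = \sum_(1 <= k < d.+1) G rho L k.
Proof. by move=> d0; rewrite /Gbar mulrA div1r mulfV ?mul1r// pnatr_eq0 -lt0n. Qed.

Lemma Gbar_gt0 d : (0 < d)%N -> (forall k, (1 <= k <= d)%N -> 0 < rho k) ->
  0 < d%:R * Gbar rho L d.
Proof.
move=> d0 r0; rewrite Gbar_sum// big_nat_recl//= ltr_pwDl//.
  by apply: G_gt0; apply: r0.
rewrite big_nat_cond; apply: sumr_ge0 => k; rewrite andbT => /andP[_ kd].
by rewrite ltW// G_gt0// r0.
Qed.

(** * Induction over the devices *)

Section sum_bound.
Variables (D : nat) (h : nat -> T -> R[i]).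
Hypothesis hrho : forall d : nat, (1 <= d <= D)%N -> 0 < rho d.
Hypothesis hCN : forall d : nat, (1 <= d <= D)%N ->
  is_CN P (h d) (1 - sigma2 rho L d).
Hypothesis hind : mutually_independent P [set d : nat | (1 <= d <= D)%N] h.
Variable y : R.
Hypothesis y0 : 0 < y.

Let V i t := ReIm (h i t).
Let g i := time (rho i).
Let W := psum V g.
Let C k := \prod_(2 <= d < k.+1) (J rho L y d / (J rho L y d + G rho L d)).
Let S k := k%:R * Gbar rho L k.

Let mV i : (1 <= i <= D)%N -> measurable_fun setT (V i).
Proof. by move=> /hCN[]. Qed.

Let mg i : (1 <= i <= D)%N -> measurable_fun setT (g i).
Proof. by move=> iD; apply: measurable_time; exact/ltW/hrho. Qed.

Let W_gt0 k t : (0 < k <= D)%N -> (0 < W k t)%E.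
Proof.
elim: k => // k IH /andP[_ kD]; rewrite /W psumS.
have gk : (0 < g k.+1 (V k.+1 t))%E by apply: time_gt0; exact/ltW/hrho.
case: k IH kD gk => [_ _ g1|k IH kD gk].
  by rewrite /psum big_geq// add0e.
by rewrite adde_gt0// IH//= ltnW.
Qed.

Let S0 k : (0 < k <= D)%N -> 0 < S k.
Proof.
case/andP => k0 kD; apply: Gbar_gt0 => // i /andP[i0 ik].
by apply: hrho; rewrite i0 (leq_trans ik).
Qed.

Let Jk k : (0 < k < D)%N ->
  [/\ is_maximum (Jvalues rho L y k.+1) (J rho L y k.+1), 0 < J rho L y k.+1 &
   forall t, 0 < t -> obj (S k) (ln 2 / y) t <= J rho L y k.+1].
Proof. by case/andP => k0 kD; apply: J_spec => //; apply: S0; rewrite k0 ltnW. Qed.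

Let C_ge0 k : (k <= D)%N -> 0 <= C k.
Proof.
move=> kD; rewrite /C big_nat_cond; apply: prodr_ge0 => -[//|i].
rewrite andbT => /andP[i2 ik]; have ikD : (0 < i < D)%N by rewrite -ltnS i2 (leq_trans _ kD).
have [_ J0 _] := Jk i ikD; have G0 : 0 < G rho L i.+1.
  by apply: G_gt0; apply: hrho; case/andP: ikD.
by rewrite divr_ge0 ?addr_ge0// ltW.
Qed.

(** The induction hypothesis is assumed for every [B >= A], since the time taken by device [k.+1]
    leaves a shorter deadline [ln 2 / B]. The factors [J] stay fixed at the deadline [y]. *)
Let W_step k (A : R) : (0 < k < D)%N -> ln 2 / y <= A ->
  (forall B, A <= B -> (P [set t | W k t <= (ln 2 / B)%:E] <=
    (expR (- (S k * (expR B - 1))) * C k)%:E)%E) ->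
  (P [set t | W k.+1 t <= (ln 2 / A)%:E] <=
    (expR (- (S k.+1 * (expR A - 1))) * C k.+1)%:E)%E.
Proof.
move=> kD yA IH; have /andP[k0 kD'] := kD.
have k1D : (0 < k.+1 <= D)%N by [].
have r0 := hrho _ k1D; have G0 := G_gt0 _ r0.
have kD1 : (k < D)%N := kD'.
have [_ J0 hJ] := Jk k kD.
have Ay0 : 0 < ln 2 / y by rewrite divr_gt0 ?ln2_gt0.
have A0 : 0 < A := lt_le_trans Ay0 yA.
(* [b] is the SNR at which device [k.+1] alone uses up the whole deadline. *)
pose b := expR A - 1; have b0 : 0 <= b by rewrite subr_ge0 -expR0 ler_expR ltW.
pose M := [set z : \bar R * (R * R) | (z.1 + g k.+1 z.2 <= (ln 2 / A)%:E)%E].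
have mM : measurable M.
  have mf : measurable_fun setT (fun z : \bar R * (R * R) => (z.1 + g k.+1 z.2)%E).
    apply: emeasurable_funD => //; apply: measurableT_comp => //; exact: mg.
  have := emeasurable_fun_infty_c measurableT mf (ln 2 / A)%:E.
  by rewrite setTI.
pose X t := snr (rho k.+1) (V k.+1 t).
have mX : measurable_fun setT X.
  by apply: measurableT_comp; [exact: measurable_snr|exact: mV].
have -> : [set t | (W k.+1 t <= (ln 2 / A)%:E)%E] = [set t | M (W k t, V k.+1 t)].
  by apply/seteqP; split => t; rewrite /M/= /W psumS.
rewrite (psum_condition P D V g mV mg hind k M)//.
rewrite -/W.
pose c := expR (- (S k * b)) * C k.
have c0 : 0 <= c by rewrite mulr_ge0 ?expR_ge0// C_ge0// ltnW.
pose phi t := (if b < X t then (1 - expR (- (J rho L y k.+1 * (X t - b)))) else 0)%:E.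
have phi0 t : (0 <= phi t)%E.
  rewrite lee_fin; case: ifP => // bX.
  by rewrite subr_ge0 -expR0 ler_expR oppr_le0 mulr_ge0 ?subr_ge0// ltW.
have mphi : measurable_fun setT phi.
  apply/measurable_EFinP; apply: measurable_fun_ifT => //; first exact: measurable_fun_ltr.
  apply: measurable_funB => //; apply: measurableT_comp => //.
  apply: measurableT_comp => //; apply: measurable_funM => //.
  exact: measurable_funB.
have pw t : (P [set s | M (W k s, V k.+1 t)] <= c%:E * phi t)%E.
  have r0' := ltW r0; rewrite /phi; case: ifPn => [bX|]; last first.
    rewrite -leNgt => Xb; rewrite mule0 (_ : [set s | _] = set0) ?measure0//.
    (* Device [k.+1] already takes at least [ln 2 / A], and the other times have a positive sum, so
       the event is empty. *)
    apply/seteqP; split => // s /=; apply/negP; rewrite -ltNge.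
    apply: (@lt_le_trans _ _ (W k s + (ln 2 / A)%:E)%E).
      by rewrite lteDr// W_gt0// k0 ltnW.
    by rewrite leeD2l// time_ge//; exact: Xb.
  have bX0 : 0 < X t - b by rewrite subr_gt0.
  (* [u] is the parameter with [1 + X t = expR (A * (1 + u))]. The time left,
     [ln 2 / A - ln 2 / (A * (1 + u))], is then [ln 2 / B] with [B = A + A / u]. *)
  have [u u0 gu] := gap_surj A _ A0 bX0.
  pose B := A + A / u; have AB : A <= B by rewrite lerDl divr_ge0 ?ltW.
  have X1 : 1 + X t = expR (A * (1 + u)).
    by move: gu; rewrite /gap /b mulrBr mulr1 -expRD mulrDr mulr1; lra.
  have Xt0 : X t != 0 by rewrite gt_eqF// (le_lt_trans b0).
  have gE : g k.+1 (V k.+1 t) = (ln 2 / (A * (1 + u)))%:E.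
    by rewrite /g timeE// -/(X t) (negbTE Xt0) X1 expRK.
  have BE : ((ln 2 / B)%:E = (ln 2 / A)%:E - (ln 2 / (A * (1 + u)))%:E)%E.
    rewrite -EFinB; congr _%:E; rewrite /B; field.
    by rewrite !gt_eqF//= ?addr_gt0// mulr_gt0// addr_gt0.
  rewrite (_ : [set s | _] = [set s | (W k s <= (ln 2 / B)%:E)%E]); last first.
    by apply/seteqP; split => s; rewrite /M /= gE BE leeBrDr.
  apply: (le_trans (IH B AB)).
  (* The part [b] of the exponent goes into the constant [c]; the part [gap A u^-1] is what
     [gap_tail_bound] compares with [gap A u = X t - b], starting from the deadline [y]. *)
  have -> : expR B - 1 = gap A u^-1 + b.
    by rewrite /gap /b /B expRD; ring.
  have -> : expR (- (S k * (gap A u^-1 + b))) * C k = c * expR (- (S k * gap A u^-1)).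
    by rewrite mulrDr opprD expRD /c; ring.
  rewrite -EFinM lee_fin ler_wpM2l// -gu.
  by apply: gap_tail_bound hJ => //; apply: S0; rewrite k0 ltnW.
apply: (@le_trans _ _ (\int[P]_t (c%:E * phi t))%E).
  apply: ge0_le_integral => //.
  - exact: (measurable_psum_section P D V g mV mg k M kD1 mM).
  - exact: emeasurable_funM.
rewrite ge0_integralZl//.
have tailX s : 0 <= s -> P [set t | s <= X t] = (expR (- (G rho L k.+1 * s)))%:E.
  exact: (snr_tail _ _ r0 (hCN _ k1D)).
apply: (le_trans (lee_wpmul2l _ (integral_exponential_tail P _ _ _ X G0 b0 J0 mX tailX))) => //.
rewrite -EFinM lee_fin.
have -> : S k.+1 = S k + G rho L k.+1.
  by rewrite /S !Gbar_sum// big_nat_recr.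
have -> : C k.+1 = C k * (J rho L y k.+1 / (J rho L y k.+1 + G rho L k.+1)).
  by rewrite /C big_nat_recr.
rewrite /c mulrDl opprD expRD -/b.
by rewrite le_eqVlt; apply/orP; left; apply/eqP; ring.
Qed.

Lemma sum_time_bound k (A : R) : (0 < k <= D)%N -> ln 2 / y <= A ->
  (P [set t | W k t <= (ln 2 / A)%:E] <=
    (expR (- (S k * (expR A - 1))) * C k)%:E)%E.
Proof.
elim: k A => // -[|k] IH A kD yA; last first.
  apply: W_step => // B AB; apply: IH => //; last exact: le_trans AB.
  by case/andP: kD => _ /ltnW.
(* For one device the bound is the exact exponential tail, and the product defining [C 1] is
   empty. *)
have Ay0 : 0 < ln 2 / y by rewrite divr_gt0 ?ln2_gt0.
have A0 : 0 < A := lt_le_trans Ay0 yA.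
have r0 := hrho _ kD.
have -> : [set t | (W 1 t <= (ln 2 / A)%:E)%E] =
    [set t | expR A - 1 <= snr (rho 1) (ReIm (h 1 t))].
  by apply/seteqP; split => t /=; rewrite /W psumS /psum big_geq// add0e time_le// ltW.
rewrite (snr_tail _ _ r0 (hCN _ kD)); last by rewrite subr_ge0 -expR0 ler_expR ltW.
by rewrite /S Gbar_sum// big_nat1 /C big_geq// mulr1.
Qed.

End sum_bound.

End channel.

Theorem proposition7 (R : realType) (disp : measure_display)
    (T : measurableType disp) (P : probability T R)
    (L D : nat) (rho : nat -> R) (h : nat -> T -> R[i])
    (hL : (1 <= L)%N) (hD : (2 <= D)%N)
    (hrho : forall d : nat, (1 <= d <= D)%N -> 0 < rho d)
    (hCN : forall d : nat, (1 <= d <= D)%N ->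
       is_CN P (h d) (1 - sigma2 rho L d))
    (hind : mutually_independent P [set d : nat | (1 <= d <= D)%N] h)
    (y : R) (hy : 0 < y) :
  (forall d : nat, (2 <= d <= D)%N ->
     is_maximum (Jvalues rho L y d) (J rho L y d)) /\
  (P [set t | (\sum_(1 <= d < D.+1) Y rho d (h d t) <= y%:E)%E] <=
   (expR (- (D%:R * Gbar rho L D * (2 `^ (1 / y) - 1))) *
    \prod_(2 <= d < D.+1) (J rho L y d / (J rho L y d + G rho L d)))%:E)%E.
Proof.
have r0 k : (k <= D)%N -> forall i, (1 <= i <= k)%N -> 0 < rho i.
  by move=> kD i /andP[i0 ik]; apply: hrho; rewrite i0 (leq_trans ik).
split=> [[//|d] /andP[d1 dD]|].
  have S0 : 0 < d%:R * Gbar rho L d by apply: Gbar_gt0 => //; exact/r0/ltnW.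
  by have [] := J_spec rho L y d.+1 hy S0.
have D0 : (0 < D <= D)%N by rewrite leqnn andbT (leq_trans _ hD).
(* The choice [A = ln 2 / y] makes the deadline [ln 2 / A] equal to [y] and [expR A] equal to the
   power in the claim. *)
have := sum_time_bound P rho L hL D h hrho hCN hind y hy D (ln 2 / y) D0 (lexx _).
have -> : ln 2 / (ln 2 / y) = y by rewrite invfM invrK mulVKf// gt_eqF// ln2_gt0.
have -> : expR (ln 2 / y) = 2 `^ (1 / y) by rewrite pow2E mul1r mulrC.
apply: le_trans; rewrite le_eqVlt; apply/orP; left; apply/eqP; congr (P _).
apply/seteqP; split => t /=; rewrite /psum; under eq_bigr do rewrite Y_time.
- by [].
- by [].
Qed.
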